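(* Let a triangular mesh $(V,T)$, an integer $N\ge 1$, and discrete densities $\bm\mu_0,\bm\mu_N\in\{\bm\mu\in\mathbb{R}_+^{|V|}\mid\sum_{\bm v\in V}|\bm v|\mu_{\bm v}=1\}$ be given as in the context, and consider the discretized dual dynamic optimal transport problem $$\min_{\bm\varphi,\bm q}\Big\{\langle\bm\varphi,\bm c\rangle_{\mathrm c,V}=\sum_{\bm v\in V}|\bm v|\varphi_{0,\bm v}\mu_{0,\bm v}-\sum_{\bm v\in V}|\bm v|\varphi_{N,\bm v}\mu_{N,\bm v}\ \Big|\ \mathcal A\bm\varphi=\bm q\equiv(\bm A;\bm B),\ \ \bm A+\tfrac12\mathcal L_t\mathcal L_s^*(|||\bm B|||^2)\le 0\Big\}$$ over $\bm\varphi\in\mathbb{R}^{\mathbf V^{\mathrm c}}$ and $\bm q\equiv(\bm A;\bm B)\in\mathbb{R}^{\mathbf V^{\mathrm{st}}}\times\mathbb{R}^{3\times\mathbf T^{\mathrm c}}$. Its KKT system, in the unknowns $\bm\varphi$, $\bm q\equiv(\bm A;\bm B)$ and the multipliers $\bm\lambda_0\in\mathbb{R}^{\mathbf V^{\mathrm{st}}}$, $\bar{\bm\lambda}\in\mathbb{R}^{3\times\mathbf T^{\mathrm c}}$, $\bm\lambda_q\in\mathbb{R}^{\mathbf V^{\mathrm{st}}}$, is $$\begin{cases}\mathcal A\bm\varphi=\bm q\equiv(\bm A;\bm B),\quad \mathcal W_{\mathrm c,V}\bm c+\mathcal A^*(\mathcal W_{\mathrm{st},V}\bm\lambda_0;\mathcal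 W_{\mathrm c,T}\bar{\bm\lambda})=0,\quad \bm\lambda_0+\bm\lambda_q=0,\\ 0\le\bm\lambda_0\perp\bm A+\tfrac12\mathcal L_t\mathcal L_s^*(|||\bm B|||^2)\le0,\quad \bar{\bm\lambda}=\big((\mathcal L_s\mathcal L_t^*\bm\lambda_0)\otimes\bm 1_3\big)\odot\bm B.\end{cases}$$ Then the solution set of this KKT system is not empty; i.e., the discretized dual dynamic optimal transport problem of minimizing $\langle\bm\varphi,\bm c\rangle_{\mathrm c,V}$ over $(\bm\varphi,\bm q)$ subject to $\mathcal A\bm\varphi=\bm q\equiv(\bm A;\bm B)$ and $\bm A+\tfrac12\mathcal L_t\mathcal L_s^*(|||\bm B|||^2)\le 0$ has both optimal solutions and Lagrange multipliers.
   Context: Mesh. $V=\{\bm v_1,\dots,\bm v_{|V|}\}\subset\mathbb{R}^3$ is a finite set of vertices and $T=\{\bm f_1,\dots,\bm f_{|T|}\}$ a finite set of nondegenerate closed triangles with vertices in $V$. Any two distinct triangles meet in the empty set, a common vertex or a common edge; every vertex belongs to at least one triangle; the mesh is connected (the union of the triangles is connected). $V_{\bm f}$ is the set of vertices of $\bm f$, $T_{\bm v}$ the set of triangles having $\bm v$ as a vertex, $|\bm f|$ the area of $\bm f$, and $|\bm v|:=\frac13\sum_{\bm f\in T_{\bm v}}|\bm f|$. For each $\bm f\in T$ an ordering $\bm v_1^{\bm f},\bm v_2^{\bm f},\bm v_3^{\bm f}$ of its vertices is fixed. Index sets. $\mathcal G^{\mathrm c}=\{0,1,\dots,N\}$, $\mathcal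 G^{\mathrm{st}}=\{\frac12,\frac32,\dots,N-\frac12\}$, $\mathbf V^{\mathrm c}=\mathcal G^{\mathrm c}\times V$, $\mathbf V^{\mathrm{st}}=\mathcal G^{\mathrm{st}}\times V$, $\mathbf T^{\mathrm c}=\mathcal G^{\mathrm c}\times T$, all ordered lexicographically with time first. $\mathbb{R}^{3\times\mathbf T^{\mathrm c}}$ is the space of families $(\bm B_{k,\bm f})_{(k,\bm f)\in\mathbf T^{\mathrm c}}$ with $\bm B_{k,\bm f}\in\mathbb{R}^3$. $(\bm x;\bm y)$ denotes vertical stacking; $\otimes$ and $\odot$ are the Kronecker and Hadamard products; vector inequalities are componentwise; $\perp$ means Euclidean inner product zero; $\bm 1_3$ is the all-ones vector. Discrete gradient. $\mathcal A=(\mathcal A_t;\mathcal A_s):\mathbb{R}^{\mathbf V^{\mathrm c}}\to\mathbb{R}^{\mathbf V^{\mathrm{st}}}\times\mathbb{R}^{3\times\mathbf T^{\mathrm c}}$ with $(\mathcal A_t\bm\varphi)_{k,\bm v}=N(\varphi_{k+\frac12,\bm v}-\varphi_{k-\frac12,\bm v})$ and $(\mathcal A_s\bm\varphi)_{k,\bm f}=\sum_{i=1}^3\varphi_{k,\bm v_i^{\bm f}}\nabla h_{\bm v_i^{\bm f}}$, where on the triangle $\bm f$ $$(\nabla h_{\bm v_1^{\bm f}},\nabla h_{\bm v_2^{\bm f}},\nabla h_{\bm v_3^{\bm f}})=J_{\bm f}(J_{\bm f}^\top J_{\bm f})^{-1}\begin{pmatrix}-1&1&0\\-1&0&1\end{pmatrix},\quad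 J_{\bm f}=(\bm v_2^{\bm f}-\bm v_1^{\bm f},\ \bm v_3^{\bm f}-\bm v_1^{\bm f})\in\mathbb{R}^{3\times2}.$$ $\mathcal A^*$ is the Euclidean adjoint (transpose) of $\mathcal A$. Weights. $\mathcal W_{\mathrm c,V}$ and $\mathcal W_{\mathrm{st},V}$ multiply the $(k,\bm v)$ component by $|\bm v|/N$ on $\mathbb{R}^{\mathbf V^{\mathrm c}}$ and $\mathbb{R}^{\mathbf V^{\mathrm{st}}}$ respectively; $\mathcal W_{\mathrm c,T}$ multiplies the $(k,\bm f)$ component (in $\mathbb{R}^3$) by $|\bm f|/N$ on $\mathbb{R}^{3\times\mathbf T^{\mathrm c}}$. $\langle\bm x,\hat{\bm x}\rangle_{\mathrm c,V}:=\langle\bm x,\mathcal W_{\mathrm c,V}\hat{\bm x}\rangle$. The vector $\bm c\in\mathbb{R}^{\mathbf V^{\mathrm c}}$ is determined by $\langle\bm\varphi,\bm c\rangle_{\mathrm c,V}=\sum_{\bm v}|\bm v|\varphi_{0,\bm v}\mu_{0,\bm v}-\sum_{\bm v}|\bm v|\varphi_{N,\bm v}\mu_{N,\bm v}$ for all $\bm\varphi$. Interpolation. $\mathcal L_t:\mathbb{R}^{\mathbf V^{\mathrm c}}\to\mathbb{R}^{\mathbf V^{\mathrm{st}}}$, $(\mathcal L_t\bm\varphi)_{k,\bm v}=\frac12(\varphi_{k+\frac12,\bm v}+\varphi_{k-\frac12,\bm v})$; $\mathcal L_s:\mathbb{R}^{\mathbf V^{\mathrm c}}\to\mathbb{R}^{\mathbf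 T^{\mathrm c}}$, $(\mathcal L_s\bm\varphi)_{k,\bm f}=\frac13\sum_{\bm v\in V_{\bm f}}\varphi_{k,\bm v}$. Their adjoints with respect to the weighted inner products are $(\mathcal L_t^*\bm\psi)_{k,\bm v}=\frac12(\psi_{k-\frac12,\bm v}+\psi_{k+\frac12,\bm v})$ for $k\in\mathcal G^{\mathrm c}$ (terms with time index outside $\mathcal G^{\mathrm{st}}$ are zero) and $(\mathcal L_s^*\bm y)_{k,\bm v}=\frac1{3|\bm v|}\sum_{\bm f\in T_{\bm v}}|\bm f|y_{k,\bm f}$. Finally $|||\bm B|||^2\in\mathbb{R}^{\mathbf T^{\mathrm c}}$ has components $\|\bm B_{k,\bm f}\|^2$ (Euclidean norm). *)

(* Defs.v *)
From HB Require Import structures.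
From mathcomp Require Import all_boot all_order all_algebra.
From mathcomp Require Import all_classical all_reals all_analysis.
From mathcomp Require Import ring.

Set Implicit Arguments.
Unset Strict Implicit.
Unset Printing Implicit Defensive.
Import Order.TTheory GRing.Theory Num.Theory.
Import numFieldNormedType.Exports.
Local Open Scope classical_set_scope.
Local Open Scope ring_scope.

(* The finite types V and T index the vertices and the triangles; [corner f]
   is the fixed ordering of the three vertices of the triangle f. *)
Record trimesh (R : realType) (V T : finType) := TriMesh {
  pos : V -> 'cV[R]_3;
  corner : T -> 'I_3 -> V
}.

Section Mesh.
Context {R : realType} {V T : finType} (M : trimesh R V T).
Implicit Types (v : V) (f g : T).

Definition verts f : {set V} := [set corner M f i | i : 'I_3]%SET.
Definition star v : {set T} := [set f | v \in verts f]%SET.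

Definition hull (S : {set V}) : set 'cV[R]_3 :=
  [set x | exists w : V -> R,
     [/\ forall v, 0 <= w v, forall v, v \notin S -> w v = 0,
         \sum_v w v = 1 & x = \sum_v w v *: pos M v]].

Definition triangle f : set 'cV[R]_3 := hull (verts f).

(* J_f = (v_2 - v_1, v_3 - v_1), corners being numbered from 0. *)
Definition Jmx f : 'M[R]_(3, 2) :=
  \matrix_(i < 3, j < 2)
    (pos M (corner M f (lift ord0 j)) i 0 - pos M (corner M f ord0) i 0).

Record is_mesh : Prop := IsMesh {
  pos_inj : injective (pos M);
  nondegenerate : forall f, \rank (Jmx f) = 2%N;
  (* A nondegenerate triangle is neither empty, nor a point, nor a segment, so
     this also forces distinct indices to denote distinct triangles. *)
  meet_face : forall f g, f != g ->
    [\/ triangle f `&` triangle g = set0,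
        exists2 v, v \in verts f :&: verts g
                 & triangle f `&` triangle g = [set pos M v]
      | exists u v, [/\ u != v, u \in verts f :&: verts g,
                        v \in verts f :&: verts g
                      & triangle f `&` triangle g = hull [set u; v]%SET]];
  vertex_used : forall v, exists f, v \in verts f;
  mesh_connected : connected (\bigcup_f triangle f)
}.

(* Half the area of the parallelogram spanned by the columns of J_f. *)
Definition tarea f : R := 2^-1 * Num.sqrt (\det ((Jmx f)^T *m Jmx f)).
Definition varea v : R := 3^-1 * \sum_(f in star v) tarea f.

(* The columns are the gradients on f of the hat functions of its corners. *)
Definition hat_grads f : 'M[R]_(3, 3) :=
  Jmx f *m invmx ((Jmx f)^T *m Jmx f)
    *m \matrix_(i < 2, j < 3) ((j == lift ord0 i)%:R - (j == ord0)%:R).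

Definition is_density (mu : V -> R) : Prop :=
  (forall v, 0 <= mu v) /\ \sum_v varea v * mu v = 1.

End Mesh.

Section Families.
Context {R : realType}.

Definition dot {I : finType} (x y : {ffun I -> R}) : R := \sum_i x i * y i.

Definition dot3 {I : finType} (X Y : {ffun I -> 'cV[R]_3}) : R :=
  \sum_i \sum_(j < 3) X i j 0 * Y i j 0.

Definition delta {I : finType} (i : I) : {ffun I -> R} :=
  [ffun j => (j == i)%:R].

Definition normsq {I : finType} (B : {ffun I -> 'cV[R]_3}) : {ffun I -> R} :=
  [ffun i => \sum_(j < 3) B i j 0 ^+ 2].

Definition kron_ones {I : finType} (y : {ffun I -> R}) :
    {ffun I -> 'cV[R]_3} := [ffun i => y i *: const_mx 1].

Definition hadamard {I : finType} (X Y : {ffun I -> 'cV[R]_3}) :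
    {ffun I -> 'cV[R]_3} := [ffun i => map2_mx *%R (X i) (Y i)].

Definition nneg {I : finType} (x : {ffun I -> R}) : Prop := forall i, 0 <= x i.
Definition npos {I : finType} (x : {ffun I -> R}) : Prop := forall i, x i <= 0.

End Families.

(* The integer times 0, ..., N are indexed by 'I_N.+1. The staggered time
   k + 1/2 is indexed by k : 'I_N; its two neighbours are [tprev k] = k and
   [tnext k] = k + 1. *)
Definition tprev {N : nat} (k : 'I_N) : 'I_N.+1 := lift ord_max k.
Definition tnext {N : nat} (k : 'I_N) : 'I_N.+1 := lift ord0 k.

Notation Vc N V := ('I_N.+1 * V)%type.
Notation Vst N V := ('I_N * V)%type.
Notation Tc N T := ('I_N.+1 * T)%type.

Section Operators.
Context {R : realType} {V T : finType} (M : trimesh R V T) {N : nat}.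

Definition grad_t (phi : {ffun Vc N V -> R}) : {ffun Vst N V -> R} :=
  [ffun kv => N%:R * (phi (tnext kv.1, kv.2) - phi (tprev kv.1, kv.2))].

Definition grad_s (phi : {ffun Vc N V -> R}) : {ffun Tc N T -> 'cV[R]_3} :=
  [ffun kf => \sum_(i < 3)
     phi (kf.1, corner M kf.2 i) *: col i (hat_grads M kf.2)].

Definition grad (phi : {ffun Vc N V -> R}) :
    {ffun Vst N V -> R} * {ffun Tc N T -> 'cV[R]_3} :=
  (grad_t phi, grad_s phi).

(* The transpose of [grad]: entry i is the inner product with column i. *)
Definition grad_adj (q : {ffun Vst N V -> R} * {ffun Tc N T -> 'cV[R]_3}) :
    {ffun Vc N V -> R} :=
  [ffun i => dot (grad (delta i)).1 q.1 + dot3 (grad (delta i)).2 q.2].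

(* W_{c,V} and W_{st,V} are the instances I := 'I_N.+1 and I := 'I_N. *)
Definition weightV {I : finType} (x : {ffun I * V -> R}) :
    {ffun I * V -> R} := [ffun kv => (varea M kv.2 / N%:R) * x kv].

Definition weightT (X : {ffun Tc N T -> 'cV[R]_3}) :
    {ffun Tc N T -> 'cV[R]_3} :=
  [ffun kf => (tarea M kf.2 / N%:R) *: X kf].

Definition innerV (x y : {ffun Vc N V -> R}) : R := dot x (weightV y).

Definition boundary_cost (mu0 muN : V -> R) (phi : {ffun Vc N V -> R}) : R :=
  \sum_v varea M v * phi (ord0, v) * mu0 v
  - \sum_v varea M v * phi (ord_max, v) * muN v.

Definition interp_t (phi : {ffun Vc N V -> R}) : {ffun Vst N V -> R} :=
  [ffun kv => 2^-1 * (phi (tnext kv.1, kv.2) + phi (tprev kv.1, kv.2))].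

Definition interp_s (phi : {ffun Vc N V -> R}) : {ffun Tc N T -> R} :=
  [ffun kf => 3^-1 * \sum_(v in verts M kf.2) phi (kf.1, v)].

(* Each sum has at most one term; it is empty, hence 0, when the staggered
   time before (resp. after) kv.1 does not exist. *)
Definition interp_t_adj (psi : {ffun Vst N V -> R}) : {ffun Vc N V -> R} :=
  [ffun kv => 2^-1 * (\sum_(j < N | tnext j == kv.1) psi (j, kv.2)
                      + \sum_(j < N | tprev j == kv.1) psi (j, kv.2))].

Definition interp_s_adj (y : {ffun Tc N T -> R}) : {ffun Vc N V -> R} :=
  [ffun kv => (3 * varea M kv.2)^-1
                * \sum_(f in star M kv.2) tarea M f * y (kv.1, f)].

Definition constraint_fun (A : {ffun Vst N V -> R})
    (B : {ffun Tc N T -> 'cV[R]_3}) : {ffun Vst N V -> R} :=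
  A + 2^-1 *: interp_t (interp_s_adj (normsq B)).

Definition feasible (phi : {ffun Vc N V -> R})
    (q : {ffun Vst N V -> R} * {ffun Tc N T -> 'cV[R]_3}) : Prop :=
  grad phi = q /\ npos (constraint_fun q.1 q.2).

Definition optimal (c : {ffun Vc N V -> R}) (phi : {ffun Vc N V -> R})
    (q : {ffun Vst N V -> R} * {ffun Tc N T -> 'cV[R]_3}) : Prop :=
  feasible phi q
  /\ forall phi' q', feasible phi' q' -> innerV phi c <= innerV phi' c.

Record KKT (c : {ffun Vc N V -> R}) (phi : {ffun Vc N V -> R})
    (q : {ffun Vst N V -> R} * {ffun Tc N T -> 'cV[R]_3})
    (lam0 : {ffun Vst N V -> R}) (lamB : {ffun Tc N T -> 'cV[R]_3})
    (lamq : {ffun Vst N V -> R}) : Prop := IsKKT {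
  kkt_grad : grad phi = q;
  kkt_continuity : weightV c + grad_adj (weightV lam0, weightT lamB) = 0;
  kkt_lamq : lam0 + lamq = 0;
  kkt_nneg : nneg lam0;
  kkt_perp : dot lam0 (constraint_fun q.1 q.2) = 0;
  kkt_npos : npos (constraint_fun q.1 q.2);
  kkt_momentum :
    lamB = hadamard (kron_ones (interp_s (interp_t_adj lam0))) q.2
}.

Lemma dot_grad_adj phi q :
  dot (grad phi).1 q.1 + dot3 (grad phi).2 q.2 = dot phi (grad_adj q).
Proof.
have suml (I J : finType) (F : I -> R) (G : I -> J -> R) (H : J -> R) :
    (forall j, H j = \sum_i F i * G i j) ->
    forall K : J -> R, \sum_j H j * K j = \sum_i F i * (\sum_j G i j * K j).
  move=> hH K; under eq_bigr => j _ do rewrite hH mulr_suml.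
  rewrite exchange_big; apply: eq_bigr => i _; rewrite mulr_sumr.
  by apply: eq_bigr => j _; rewrite mulrA.
have pick (x : Vc N V) : phi x = \sum_i phi i * delta i x.
  rewrite (bigD1 x) //= big1 ?ffunE ?eqxx ?mulr1 ?addr0 // => i ix.
  by rewrite ffunE eq_sym (negbTE ix) mulr0.
have -> : dot phi (grad_adj q) =
    \sum_i phi i * dot (grad (delta i)).1 q.1
    + \sum_i phi i * dot3 (grad (delta i)).2 q.2.
  by rewrite -big_split; apply: eq_bigr => i _; rewrite [grad_adj _ _]ffunE mulrDr.
congr (_ + _).
  apply: suml => kv; rewrite ffunE (pick (tnext _, _)) (pick (tprev _, _)).
  rewrite -sumrB mulr_sumr; apply: eq_bigr => i _.
  by rewrite [in RHS]ffunE -mulrBr mulrCA.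
rewrite /dot3 pair_big /=.
under [RHS]eq_bigr => i _ do rewrite pair_big /=.
apply: (suml _ _ (fun i => phi i)
  (fun i p => (grad (delta i)).2 p.1 p.2 0) (fun p => (grad phi).2 p.1 p.2 0)
  _ (fun p => q.2 p.1 p.2 0)) => -[kf j] /=.
rewrite ffunE summxE.
under [LHS]eq_bigr => l _ do rewrite mxE pick mulr_suml.
rewrite exchange_big; apply: eq_bigr => i _; rewrite [in RHS]ffunE summxE.
by rewrite mulr_sumr; apply: eq_bigr => l _; rewrite [in RHS]mxE mulrA.
Qed.

(* The cost vector in [innerV] exists as soon as there is a time step. *)
Lemma boundary_cost_rep mu0 muN : (0 < N)%N ->
  exists c, forall phi, innerV phi c = boundary_cost mu0 muN phi.
Proof.
move=> N0; have NR : (N%:R : R) != 0 by rewrite pnatr_eq0 -lt0n.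
exists [ffun kv => N%:R * (((kv.1 == ord0)%:R) * mu0 kv.2
                           - ((kv.1 == ord_max)%:R) * muN kv.2)] => phi.
rewrite /innerV /dot; set c := finfun _.
have -> : \sum_i phi i * weightV c i =
    \sum_k \sum_v phi (k, v) * weightV c (k, v).
  by rewrite pair_big; apply: eq_bigr => -[].
rewrite exchange_big /boundary_cost -sumrB; apply: eq_bigr => v _.
have termE k : phi (k, v) * weightV c (k, v) =
    (k == ord0)%:R * (varea M v * phi (k, v) * mu0 v)
    - (k == ord_max)%:R * (varea M v * phi (k, v) * muN v).
  by rewrite !ffunE /=; field.
have sel (a : 'I_N.+1) (F : 'I_N.+1 -> R) : \sum_k (k == a)%:R * F k = F a.
  rewrite (bigD1 a) //= eqxx mul1r big1 ?addr0 // => k /negbTE ->.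
  by rewrite mul0r.
by under eq_bigr => k _ do rewrite termE; rewrite sumrB !sel.
Qed.

End Operators.

(* Main.v *)
Require Import Defs.
From mathcomp Require Import all_boot all_order all_algebra.
From mathcomp Require Import all_classical all_reals all_analysis.
From mathcomp Require Import ring lra.

Set Implicit Arguments.
Unset Strict Implicit.
Unset Printing Implicit Defensive.
Import Order.TTheory GRing.Theory Num.Theory.
Import numFieldNormedType.Exports.
Local Open Scope classical_set_scope.
Local Open Scope ring_scope.

(** The dual problem minimizes a linear cost over the potentials phi that
    satisfy, at each staggered node (k, v), a convex quadratic inequality
    g_(k, v)(phi) <= 0; the quadratic part of g_(k, v) is half the average,
    over the two neighbouring times, of the local energy L_s^*(|||B|||^2) of
    the spatial gradient B of phi.  The proof has three ingredients.

    Coercivity ([sublevel_bounded]).  If g_(k, v)(phi) is not positive, then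
    phi(., v) decreases in time by at least a multiple of the local energy.
    Hence phi_0 - phi_N, summed over the vertices, dominates the total energy
    of all time slices.  The cost compares a mean of phi_0 with a mean of
    phi_N, for two different probability weights; replacing both by the value
    at one vertex costs at most the oscillations of phi_0 and phi_N, and these
    grow only like the square root of the energy, because the mesh is connected
    ([oscillation_le]).  A bound on the cost therefore bounds the energy, then
    the oscillation of each slice and, by monotonicity, phi up to an additive
    constant.  The cost and the constraints ignore additive constants.

    Strict feasibility.  A potential that is constant in space and decreases
    at unit rate per time step has no spatial gradient, so g = - N there.

    Multipliers ([multipliers_exist]).  The penalized function
    cost + (n / 2) sum_j (g_j^+)^2 is still coercive and attains its minimum at
    some x_n; its stationarity is the Lagrange equation with multipliers
    n g_j^+(x_n).  Convexity and the strictly feasible point bound these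
    multipliers independently of n, which also forces g_j^+(x_n) = O(1 / n).
    So the compact set of pairs (x, lam) in a fixed box, with lam >= 0,
    lam_j g_j(x) >= 0 and the Lagrange equation, contains points whose
    constraint violation is arbitrarily small, hence a point without
    violation; there lam_j g_j(x) >= 0 becomes complementarity.

    The adjointness of the interpolation operators ([lagrangian_derivative])
    turns the Lagrange equation into the continuity equation of the KKT system,
    and convexity of the Lagrangian ([lagrangian_le]) makes every KKT point
    optimal. *)

(** * Lagrange multipliers for coercive convex quadratic programs *)

Section QuadraticProgram.
Import ArrowAsProduct.
Context {R : realType}.

Definition pos_part (x : R) : R := Num.max x 0.

Lemma pos_part_ge0 x : 0 <= pos_part x.
Proof. by rewrite le_max lexx orbT. Qed.

Lemma le_pos_part x : x <= pos_part x.
Proof. by rewrite le_max lexx. Qed.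

Lemma pos_part_le0 x : pos_part x <= 0 -> x <= 0.
Proof. exact/le_trans/le_pos_part. Qed.

Lemma pos_partE x : x <= 0 -> pos_part x = 0.
Proof. by move=> x0; apply/max_idPr. Qed.

Lemma pos_part_mulr_ge0 x : 0 <= pos_part x * x.
Proof.
rewrite /pos_part; case: (leP x 0) => [_|/ltW x0]; first by rewrite mul0r.
by rewrite mulr_ge0.
Qed.

(** A one-sided second order expansion of the squared positive part, which
    replaces the derivative of the penalty at a minimizer. *)
Lemma sqr_pos_partD a b :
  pos_part (a + b) ^+ 2 <= pos_part a ^+ 2 + 2 * pos_part a * b + b ^+ 2.
Proof.
by rewrite /pos_part; case: (leP (a + b) 0) => ?; case: (leP a 0) => ?; nra.
Qed.

(** First order optimality without derivatives: near t = 0 the linear term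
    dominates, so it must vanish. *)
Lemma linear_coef_eq0 (a m : R) :
  (forall t, `|t| <= 1 -> 0 <= t * a + t ^+ 2 * m) -> a = 0.
Proof.
move=> h; apply/eqP/negPn/negP => a0.
have m1 : 0 < `|m| + 1 + `|a| by rewrite ltr_wpDr// ltr_wpDl.
have ha : 0 < `|a| by rewrite normr_gt0.
have nm := normr_ge0 m.
have lem := ler_norm m.
pose r := (`|m| + 1 + `|a|)^-1.
have r0 : 0 < r by rewrite invr_gt0.
have rE : r * (`|m| + 1 + `|a|) = 1 by rewrite mulVf// gt_eqF.
have rm0 : 0 <= r * `|m| by rewrite mulr_ge0// ltW.
have hr : `|- (a * r)| <= 1 by rewrite normrN normrM (gtr0_norm r0); nra.
(* At t = - a r the expression is r |a|^2 (r m - 1), and r m < 1. *)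
have := h _ hr.
have -> : - (a * r) * a + (- (a * r)) ^+ 2 * m = r * (`|a| ^+ 2) * (r * m - 1).
  by rewrite real_normK ?num_real//; ring.
apply/negP; rewrite -ltNge pmulr_rlt0 ?mulr_gt0 ?exprn_gt0//.
have : r * m <= r * `|m| by rewrite ler_pM2l.
by nra.
Qed.

Section Continuity.
Context {X : topologicalType}.
Implicit Types F G : X -> R.

Lemma cont_add F G : continuous F -> continuous G ->
  continuous (fun x => F x + G x).
Proof. by move=> hF hG x; apply: cvgD; [exact: hF|exact: hG]. Qed.

Lemma cont_mul F G : continuous F -> continuous G ->
  continuous (fun x => F x * G x).
Proof. by move=> hF hG x; apply: cvgM; [exact: hF|exact: hG]. Qed.

Lemma cont_opp F : continuous F -> continuous (fun x => - F x).
Proof. by move=> hF x; apply: cvgN; exact: hF. Qed.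

Lemma cont_cst (a : R) : continuous (fun _ : X => a).
Proof. exact: cst_continuous. Qed.

Lemma cont_sum (I : Type) (r : seq I) (P : pred I) (F : I -> X -> R) :
  (forall i, continuous (F i)) ->
  continuous (fun x => \sum_(i <- r | P i) F i x).
Proof.
by move=> hF; apply: continuous_big => [|i _]; [exact: add_continuous|exact: hF].
Qed.

Lemma cont_pos_part F : continuous F -> continuous (fun x => pos_part (F x)).
Proof.
move=> hF x; apply: (@continuous_max R X F (fun=> 0)); first exact: hF.
exact: cst_continuous.
Qed.

Lemma cont_comp (Y : topologicalType) (h : X -> Y) (G : Y -> R) :
  continuous h -> continuous G -> continuous (fun x => G (h x)).
Proof. by move=> hh hG x; apply: continuous_comp; [exact: hh|exact: hG]. Qed.

Lemma cont_le F G : continuous F -> continuous G ->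
  closed [set x | F x <= G x].
Proof.
move=> hF hG.
have -> : [set x | F x <= G x] = (fun x => G x + - F x) @^-1` [set r | 0 <= r].
  by apply/seteqP; split => x /=; rewrite subr_ge0.
apply: preimage_closed; last exact: closed_ge.
by move=> x _; apply: cont_add => //; exact: cont_opp.
Qed.

End Continuity.

Lemma cont_coord (I : finType) (i : I) : continuous (fun x : I -> R => x i).
Proof. exact: (@proj_continuous I (fun=> R) i). Qed.

(** Functions on I carry the product topology, so this is Tychonoff's theorem. *)
Lemma box_compact (I : finType) (lo hi : R) :
  compact [set x : I -> R | forall i, lo <= x i <= hi].
Proof.
have := @tychonoff I (fun=> R) (fun=> [set` `[lo, hi]])
  (fun=> @segment_compact R lo hi).
congr (compact _); apply/seteqP; split => x /= h i;
  by have := h i; rewrite in_itv.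
Qed.

Lemma continuous_min_on (X : topologicalType) (A : set X) (F : X -> R) :
  A !=set0 -> compact A -> continuous F ->
  exists2 x, A x & forall y, A y -> F x <= F y.
Proof.
move=> A0 cA cF.
have [x /set_mem Ax xmin] :=
  compact_EVT_min A0 cA (continuous_subspaceT cF).
by exists x => // y Ay; apply: xmin; rewrite inE.
Qed.


Section Multipliers.
Context {I J : finType} (f : (I -> R) -> R) (g : J -> (I -> R) -> R).
Context (dg : J -> (I -> R) -> (I -> R) -> R) (q : J -> (I -> R) -> R).

Definition move_by (x y : I -> R) (t : R) : I -> R := fun i => x i + t * y i.

(** The quadratic exterior penalty of the constraints g_j <= 0. *)
Definition excess (x : I -> R) : R := \sum_j pos_part (g j x) ^+ 2.

Context (f_cont : continuous f) (g_cont : forall j, continuous (g j)).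
Context (dg_cont : forall j y, continuous (fun x => dg j x y)).
Context (f_line : forall x y t, f (move_by x y t) = f x + t * f y).
Context (g_line : forall j x y t,
  g j (move_by x y t) = g j x + t * dg j x y + t ^+ 2 * q j y).
Context (q_ge0 : forall j y, 0 <= q j y).

(** Convexity of g_j in its gradient form: the curvature term of the expansion
    is nonnegative. *)
Lemma dg_sub_le j x z : g j x + dg j x (fun i => z i - x i) <= g j z.
Proof.
have {2}-> : z = move_by x (fun i => z i - x i) 1.
  by apply/funext => i; rewrite /move_by mul1r addrC subrK.
by rewrite g_line expr1n !mul1r lerDl.
Qed.

Lemma f_sub x z : f (fun i => z i - x i) = f z - f x.
Proof.
have {2}-> : z = move_by x (fun i => z i - x i) 1.
  by apply/funext => i; rewrite /move_by mul1r addrC subrK.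
by rewrite f_line mul1r addrC addKr.
Qed.

(** A stationary point of the Lagrangian is a global minimizer of it, by
    convexity. This bounds the multipliers of the penalized problems, and it also
    shows that KKT points are optimal. *)
Lemma lagrangian_le x z (lam : J -> R) :
  (forall j, 0 <= lam j) ->
  (forall y, f y + \sum_j lam j * dg j x y = 0) ->
  f x + \sum_j lam j * g j x <= f z + \sum_j lam j * g j z.
Proof.
move=> lam0 /(_ (fun i => z i - x i)); rewrite f_sub => st.
suff : \sum_j lam j * g j x + \sum_j lam j * dg j x (fun i => z i - x i)
       <= \sum_j lam j * g j z by move: st; lra.
rewrite -big_split; apply: ler_sum => j _ /=.
by rewrite -mulrDr ler_wpM2l// dg_sub_le.
Qed.

Lemma excess_ge0 x : 0 <= excess x.
Proof. by apply: sumr_ge0 => j _; rewrite exprn_ge0// pos_part_ge0. Qed.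

(** The derivative of (n / 2) (g_j^+)^2 is n g_j^+ dg_j, so the penalized
    minimizer satisfies the Lagrange equation with multipliers n g_j^+. *)
Lemma penalty_stationary x (n : R) : 0 < n ->
  (forall z, f x + n / 2 * excess x <= f z + n / 2 * excess z) ->
  forall y, f y + \sum_j n * pos_part (g j x) * dg j x y = 0.
Proof.
move=> n0 xmin y.
(* An upper bound, for |t| <= 1, of the coefficient of t^2. *)
pose m := n / 2 * \sum_j (2 * pos_part (g j x) * q j y
                            + (`|dg j x y| + q j y) ^+ 2).
apply: (@linear_coef_eq0 _ m) => t t1.
have := xmin (move_by x y t); rewrite f_line.
suff : excess (move_by x y t) <= excess x
   + \sum_j (t * (2 * pos_part (g j x) * dg j x y)
    + t ^+ 2 * (2 * pos_part (g j x) * q j y + (`|dg j x y| + q j y) ^+ 2)).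
  rewrite big_split /= -!mulr_sumr /m.
  have -> : \sum_j n * pos_part (g j x) * dg j x y =
     n / 2 * \sum_j 2 * pos_part (g j x) * dg j x y.
    by rewrite mulr_sumr; apply: eq_bigr => j _; field.
  set e' := excess _; set e := excess _; set a := \sum_j _; set b := \sum_j _.
  move=> h1 h2.
  have : n / 2 * e' <= n / 2 * (e + (t * a + t ^+ 2 * b)).
    by rewrite ler_wpM2l// divr_ge0// ltW.
  by nra.
rewrite -big_split; apply: ler_sum => j _ /=.
rewrite g_line -addrA; apply: le_trans (sqr_pos_partD _ _) _.
set p := pos_part _; set d := dg _ _ _; set s := q _ _.
have s0 : 0 <= s by exact: q_ge0.
have : (t * d + t ^+ 2 * s) ^+ 2 <= t ^+ 2 * (`|d| + s) ^+ 2.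
  have -> : (t * d + t ^+ 2 * s) ^+ 2 = t ^+ 2 * (`|d + t * s| ^+ 2).
    by rewrite real_normK ?num_real//; ring.
  rewrite ler_wpM2l ?sqr_ge0// ler_sqr ?nnegrE ?addr_ge0//.
  by rewrite (le_trans (ler_normD _ _))// lerD2l normrM (ger0_norm s0) ler_piMl.
by nra.
Qed.

Context (x0 : I -> R) (s : R) (s_gt0 : 0 < s) (slater : forall j, g j x0 <= - s).
Context (coercive : forall K : R, exists C : R, forall x, f x + 2^-1 * excess x <= K ->
  exists y, [/\ forall i, `|y i| <= C, f y = f x & forall j, g j y = g j x]).

Lemma excess_slater : excess x0 = 0.
Proof.
apply: big1 => j _; rewrite pos_partE ?expr0n//.
by apply: le_trans (slater j) _; rewrite oppr_le0 ltW.
Qed.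

Lemma excess_eq x y : (forall j, g j y = g j x) -> excess y = excess x.
Proof. by move=> h; apply: eq_bigr => j _; rewrite h. Qed.

(** Coercivity at the single level f x0 suffices for all n at once: the penalized
    value of x0 is f x0 for every n, and penalties with n >= 1 dominate the one
    with n = 1. Thus all the minimizers lie in one box. *)
Lemma penalty_min : exists C : R, forall n : R, 1 <= n ->
  exists2 x : I -> R, forall i, - C <= x i <= C &
    forall z, f x + n / 2 * excess x <= f z + n / 2 * excess z.
Proof.
have [C hC] := coercive (f x0); exists C => n n1.
have C0 : exists2 y, forall i, - C <= y i <= C & f y = f x0 /\ excess y = excess x0.
  have [|y [yC fy gy]] := hC x0; first by rewrite excess_slater mulr0 addr0.
  by exists y => [i|]; [rewrite -ler_norml|split=> //; exact: excess_eq].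
have [y0 y0C [fy0 ey0]] := C0.
have [x xC xmin] : exists2 x : I -> R, (forall i, - C <= x i <= C) &
    forall z : I -> R, (forall i, - C <= z i <= C) ->
    f x + n / 2 * excess x <= f z + n / 2 * excess z.
  apply: (@continuous_min_on (I -> R) [set x | forall i, - C <= x i <= C]
    (fun x => f x + n / 2 * excess x)).
  - by exists y0.
  - exact: box_compact.
  - apply: cont_add => //; apply: cont_mul; first exact: cont_cst.
    by apply: cont_sum => j; apply: cont_mul; exact: cont_pos_part.
exists x => // z.
have [zK|zK] := leP (f z + 2^-1 * excess z) (f x0).
  have [y [yC fy gy]] := hC z zK.
  rewrite -fy -(excess_eq gy); apply: xmin => i.
  by rewrite -ler_norml.
have := xmin y0 y0C; rewrite fy0 ey0 excess_slater mulr0 addr0 => /le_trans; apply.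
by have := excess_ge0 z; nra.
Qed.

(** The limit n -> +oo of the penalized problems is taken by minimizing the
    total violation over a compact set instead of extracting subsequences. *)
Lemma multipliers_exist : exists (x : I -> R) (lam : J -> R),
  [/\ forall j, 0 <= lam j, forall j, g j x <= 0, forall j, lam j * g j x = 0 &
      forall y, f y + \sum_j lam j * dg j x y = 0].
Proof.
have [C hC] := penalty_min.
have [xf _ xfmin] : exists2 x : I -> R, (forall i, - C <= x i <= C) &
    forall z : I -> R, (forall i, - C <= z i <= C) -> f x <= f z.
  have [y yC _] := hC 1 (lexx _).
  apply: (@continuous_min_on (I -> R) [set x | forall i, - C <= x i <= C] f) => //.
    by exists y.
  exact: box_compact.
(* The Slater bound: lam_j s <= f x0 - f x for each approximate multiplier. *)
pose L := (f x0 - f xf) / s.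
have approx (n : R) : 1 <= n -> exists x : I -> R, [/\ forall i, - C <= x i <= C,
    forall j, 0 <= n * pos_part (g j x) <= L &
    forall y, f y + \sum_j n * pos_part (g j x) * dg j x y = 0].
  move=> n1; have n0 : 0 < n by apply: lt_le_trans n1.
  have [x xC xmin] := hC n n1; exists x.
  have st := penalty_stationary n0 xmin.
  have lam0 j : 0 <= n * pos_part (g j x) by rewrite mulr_ge0 ?pos_part_ge0// ltW.
  split => // j; rewrite lam0 /= /L ler_pdivlMr//.
  have := lagrangian_le x0 lam0 st.
  have h1 : 0 <= \sum_i n * pos_part (g i x) * g i x.
    apply: sumr_ge0 => i _; rewrite -mulrA mulr_ge0 ?pos_part_mulr_ge0//.
    exact: ltW.
  have h2 : \sum_i n * pos_part (g i x) * g i x0 <= - (n * pos_part (g j x) * s).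
    rewrite (bigD1 j)//= -[leRHS]addr0 lerD//.
      by rewrite -mulrN ler_wpM2l.
    apply: sumr_le0 => i _; apply: mulr_ge0_le0 => //.
    by apply: le_trans (slater i) _; rewrite oppr_le0 ltW.
  by have := xfmin _ xC; lra.
(* The approximate solutions satisfy lam_j g_j >= 0 because lam_j is a
   nonnegative multiple of g_j^+; this closed condition survives in the limit. *)
pose K := [set z : (I -> R) * (J -> R) | (forall i, - C <= z.1 i <= C) /\
  (forall j, 0 <= z.2 j <= L)] `&` ((\bigcap_j [set z | 0 <= z.2 j * g j z.1]) `&`
  (\bigcap_y [set z | f y + \sum_j z.2 j * dg j z.1 y = 0])).
have inK (n : R) : 1 <= n -> exists2 z, K z & forall j, z.2 j = n * pos_part (g j z.1).
  move=> /[dup] n1 /approx [x [xC lamL st]].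
  exists (x, fun j => n * pos_part (g j x)) => //; split => //.
  split => [j _|y _] /=; last exact: st.
  by rewrite -mulrA mulr_ge0 ?pos_part_mulr_ge0// (le_trans ler01).
have c1 : continuous (@fst (I -> R) (J -> R)) by move=> ?; exact: cvg_fst.
have c2 : continuous (@snd (I -> R) (J -> R)) by move=> ?; exact: cvg_snd.
have c2j j : continuous (fun z : (I -> R) * (J -> R) => z.2 j).
  exact: (cont_comp c2 (@cont_coord J j)).
have cK : compact K.
  apply: compact_closedI.
    exact: (compact_setX (@box_compact I (- C) C) (@box_compact J 0 L)).
  apply: closedI.
    apply: closed_bigI => j _; apply: cont_le; first exact: cont_cst.
    by apply: cont_mul => //; exact: (cont_comp c1 (@g_cont j)).
  apply: closed_bigI => y _.
  have cst : continuous (fun z : (I -> R) * (J -> R) =>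
      f y + \sum_j z.2 j * dg j z.1 y).
    apply: cont_add; first exact: cont_cst.
    apply: cont_sum => j; apply: cont_mul => //.
    exact: (cont_comp c1 (@dg_cont j y)).
  rewrite -[X in closed X]/((fun z : (I -> R) * (J -> R) =>
      f y + \sum_j z.2 j * dg j z.1 y) @^-1` [set r | r = 0]).
  by apply: preimage_closed => [z _|]; [exact: cst|exact: closed_eq].
have [[x lam] Kx xmin] : exists2 z, K z & forall z', K z' ->
    \sum_j pos_part (g j z.1) <= \sum_j pos_part (g j z'.1).
  apply: (@continuous_min_on _ K (fun z => \sum_j pos_part (g j z.1))) => //.
    by have [z Kz _] := inK 1 (lexx _); exists z.
  by apply: cont_sum => j; apply: cont_pos_part; exact: (cont_comp c1 (@g_cont j)).
have gx0 : \sum_j pos_part (g j x) <= 0.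
  rewrite leNgt; apply/negP => sg.
  (* A value of n for which n times the least violation exceeds its bound sum_j L. *)
  pose n := 1 + `|\sum_(j : J) L| / \sum_j pos_part (g j x).
  have n1 : 1 <= n by rewrite lerDl divr_ge0// ltW.
  have [z Kz zE] := inK n n1.
  have := xmin z Kz => /= hle.
  have : n * \sum_j pos_part (g j x) <= \sum_(j : J) L.
    rewrite (le_trans (ler_wpM2l _ hle))// ?(le_trans ler01)// mulr_sumr.
    by apply: ler_sum => j _; rewrite -zE; case: Kz => -[_ /(_ j) /andP[]].
  rewrite /n mulrDl mul1r divfK ?gt_eqF// => h.
  by have := ler_norm (\sum_(j : J) L); lra.
have gle j : g j x <= 0.
  apply: pos_part_le0; apply: le_trans gx0; rewrite (bigD1 j)//= lerDl.
  by apply: sumr_ge0 => i _; exact: pos_part_ge0.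
have [[_ lamL] [comp st]] := Kx.
have lam0 j : 0 <= lam j by have /andP[] := lamL j.
exists x, lam; split => // [j|y]; last exact: st.
apply/eqP; rewrite eq_le; apply/andP; split; last exact: (comp j).
exact: mulr_ge0_le0.
Qed.

End Multipliers.
End QuadraticProgram.

(** * Geometry of the mesh *)

Lemma det_mx2 (R : comNzRingType) (A : 'M[R]_2) :
  \det A = A ord0 ord0 * A ord_max ord_max - A ord0 ord_max * A ord_max ord0.
Proof.
rewrite (expand_det_row _ ord0) !big_ord_recl big_ord0 /cofactor.
rewrite !(expand_det_row _ ord0) !big_ord_recl !big_ord0 /cofactor !det_mx00.
rewrite !mxE /= (_ : lift ord0 ord0 = ord_max); last exact: val_inj.
rewrite (_ : lift ord_max ord0 = ord0); last exact: val_inj.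
by rewrite /bump /=; ring.
Qed.
(** Lagrange's identity: the Gram determinant is the sum of the squares of the
    2 x 2 minors. *)
Lemma det_gram_ge0 (R : realDomainType) (J : 'M[R]_(3, 2)) : 0 <= \det (J^T *m J).
Proof.
rewrite det_mx2 !mxE !big_ord_recl !big_ord0 !mxE.
set a1 := J ord0 ord0; set a2 := J ord0 ord_max.
set b1 := J (lift ord0 ord0) ord0; set b2 := J (lift ord0 ord0) ord_max.
set c1 := J (lift _ (lift _ _)) ord0; set c2 := J (lift _ (lift _ _)) ord_max.
have -> : (a1 * a1 + (b1 * b1 + (c1 * c1 + 0))) *
   (a2 * a2 + (b2 * b2 + (c2 * c2 + 0))) -
   (a1 * a2 + (b1 * b2 + (c1 * c2 + 0))) *
   (a2 * a1 + (b2 * b1 + (c2 * c1 + 0)))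
   = (a1 * b2 - b1 * a2) ^+ 2 + (a1 * c2 - c1 * a2) ^+ 2 + (b1 * c2 - c1 * b2) ^+ 2.
  by ring.
by rewrite !addr_ge0// sqr_ge0.
Qed.

Lemma sum_indicator (R : pzSemiRingType) (I : finType) (a : I) (F : I -> R) :
  \sum_i (i == a)%:R * F i = F a.
Proof.
rewrite (bigD1 a) //= big1 ?eqxx ?mul1r ?addr0 // => i /negbTE ->.
by rewrite mul0r.
Qed.

Section MeshGeometry.
Context {R : realType} {V T : finType} (M : trimesh R V T) (hM : is_mesh M).
Implicit Types (v w : V) (f : T).

(** If u J^T J = 0, then |u J^T|^2 = 0, and J^T has independent rows. *)
Lemma gram_unit f : (Jmx M f)^T *m Jmx M f \in unitmx.
Proof.
rewrite -row_free_unit; apply: inj_row_free => u; rewrite mulmxA => uG0.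
have JT_free : row_free (Jmx M f)^T.
  by rewrite /row_free mxrank_tr (Defs.nondegenerate hM).
apply/eqP; rewrite -(mulmx_free_eq0 u JT_free); apply/eqP/rowP => i.
have : \sum_j (u *m (Jmx M f)^T) 0 j ^+ 2 = 0.
  have := congr1 (fun A => fun_of_matrix A 0 0) (congr1 (mulmx^~ u^T) uG0).
  rewrite mul0mx [in RHS]mxE -mulmxA -{2}[Jmx M f]trmxK -trmx_mul [LHS]mxE => h.
  by rewrite -[RHS]h; apply: eq_bigr => j _; rewrite [_^T j 0]mxE expr2.
move/eqP; rewrite psumr_eq0 => [/allP/(_ i)|j _]; last exact: sqr_ge0.
by rewrite mem_index_enum sqrf_eq0 => /(_ isT)/eqP ->; rewrite mxE.
Qed.

Lemma gram_det_gt0 f : 0 < \det ((Jmx M f)^T *m Jmx M f).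
Proof.
rewrite lt_neqAle eq_sym det_gram_ge0 andbT.
by have := gram_unit f; rewrite unitmxE unitfE.
Qed.

Lemma tarea_gt0 f : 0 < tarea M f.
Proof. by rewrite mulr_gt0 ?invr_gt0// sqrtr_gt0 gram_det_gt0. Qed.

Lemma varea_gt0 v : 0 < varea M v.
Proof.
have [f vf] := vertex_used hM v.
rewrite mulr_gt0 ?invr_gt0// (bigD1 f) ?inE//= ltr_pwDl ?tarea_gt0//.
by apply: sumr_ge0 => g _; exact/ltW/tarea_gt0.
Qed.

Definition face_grad (x : V -> R) f : 'cV[R]_3 :=
  \sum_(i < 3) x (corner M f i) *: col i (hat_grads M f).

Lemma face_gradE x f :
  face_grad x f = hat_grads M f *m (\col_i x (corner M f i)).
Proof.
apply/colP => i; rewrite /face_grad summxE mxE; apply: eq_bigr => j _.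
by rewrite !mxE mulrC.
Qed.

(** The affine interpolant has the prescribed differences along the edges,
    because J^T times the matrix of hat gradients is the difference matrix. *)
Lemma face_grad_edge x f (j : 'I_2) :
  x (corner M f (lift ord0 j)) - x (corner M f ord0) =
  \sum_(i < 3) Jmx M f i j * face_grad x f i 0.
Proof.
transitivity (((Jmx M f)^T *m face_grad x f) j 0); last first.
  by rewrite mxE; apply: eq_bigr => i _; rewrite [_^T _ _]mxE.
rewrite face_gradE /hat_grads !mulmxA mulmxV ?gram_unit// mul1mx mxE.
under eq_bigr => i _ do rewrite !mxE mulrBl.
by rewrite sumrB !sum_indicator.
Qed.

Lemma pos_in_triangle v f : v \in verts M f -> triangle M f (pos M v).
Proof.
move=> vf; exists (fun w => (w == v)%:R); split => [w|w|//|].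
- by rewrite ler0n.
- by move=> wf; case: eqP wf => // ->; rewrite vf.
- by rewrite (bigD1 v)//= eqxx big1 ?addr0// => w /negbTE ->.
- rewrite (bigD1 v)//= eqxx scale1r big1 ?addr0// => w /negbTE ->.
  by rewrite scale0r.
Qed.

Lemma corner_verts f i : corner M f i \in verts M f.
Proof. exact: imset_f. Qed.

Section HullClosed.
Import ArrowAsProduct.

(** The hull is the image of a compact simplex of weights. *)
Lemma closed_hull (S : {set V}) : closed (hull M S).
Proof.
pose A := [set w : V -> R | forall v, 0 <= w v <= 1] `&`
  ((\bigcap_(v in [set v | v \notin S]) [set w | w v = 0]) `&`
   [set w | \sum_v w v = 1]).
have closed_zero (F : (V -> R) -> R) a : continuous F -> closed [set w | F w = a].
  move=> cF; rewrite -[X in closed X]/(F @^-1` [set r | r = a]).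
  by apply: preimage_closed => [w _|]; [exact: cF|exact: closed_eq].
have cA : compact A.
  apply: compact_closedI; first exact: box_compact.
  apply: closedI.
    by apply: closed_bigI => v _; apply: closed_zero; exact: cont_coord.
  by apply: closed_zero; apply: cont_sum => v; exact: cont_coord.
have -> : hull M S = (fun w : V -> R => \sum_v w v *: pos M v) @` A.
  apply/seteqP; split => [x [w [w0 wS w1 ->]]|x [w [wb [wS w1]] <-]].
    exists w => //; split => [v|]; last by split.
    rewrite w0 -w1 (bigD1 v)//= lerDl; exact: sumr_ge0.
  by exists w; split => // v; have /andP[] := wb v.
apply: compact_closed; first exact: norm_hausdorff.
apply: continuous_compact => //; apply: continuous_subspaceT.
apply: continuous_big => [|v _]; first exact: add_continuous.
by move=> w; apply: continuousZr_tmp; exact: cont_coord.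
Qed.

End HullClosed.

(** Connectedness of the surface becomes connectedness of the vertex graph.
    Triangles on either side of S have no common vertex, hence are disjoint by
    the mesh condition, and the two finite unions of closed triangles would
    separate the surface. *)
Lemma mesh_connected_verts (S : {set V}) u : u \in S ->
  (forall f v w, v \in verts M f -> w \in verts M f -> v \in S -> w \in S) ->
  forall v, v \in S.
Proof.
move=> uS Sclosed v; apply/negPn/negP => vS.
pose B := \bigcup_(f in [set f | corner M f ord0 \in S]) triangle M f.
pose C := \bigcup_(f in [set f | corner M f ord0 \notin S]) triangle M f.
have closedU (P : set T) : closed (\bigcup_(f in P) triangle M f).
  apply: closed_bigcup; first exact: finite_finset.
  by move=> f _; exact: closed_hull.
have disj x : B x -> ~ C x.
  move=> [g gS xg] [f /= fS xf].
  have fS' w : w \in verts M f :&: verts M g -> False.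
    rewrite inE => /andP[wf wg]; move/negP: fS; apply.
    apply: (Sclosed f w) => //; first exact: corner_verts.
    by apply: (Sclosed g (corner M g ord0)) => //; exact: corner_verts.
  have fg : f != g by apply: contraNneq fS => ->.
  case: (meet_face hM fg) => [h|[w /fS' //]|[w [w' [_ /fS' //]]]].
  by have : (triangle M f `&` triangle M g) x by []; rewrite h.
have BA : B = \bigcup_f triangle M f.
  apply: (mesh_connected hM).
  - have [f uf] := vertex_used hM u; exists (pos M u), f; last exact: pos_in_triangle.
    by apply: (Sclosed f u) => //; exact: corner_verts.
  - exists (~` C); first by rewrite openC; exact: closedU.
    apply/seteqP; split => x.
      by move=> Bx; split; [case: Bx => f _ xf; exists f|exact: disj].
    move=> [[f _ xf] nC]; have [fS|fS] := boolP (corner M f ord0 \in S).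
      by exists f.
    by exfalso; apply: nC; exists f.
  - exists B; first exact: closedU.
    by apply/seteqP; split => x => [[f fS xf]|[]//]; split; exists f.
have [f vf] := vertex_used hM v.
have fS : corner M f ord0 \notin S.
  apply: contra vS => fS; apply: (Sclosed f (corner M f ord0)) => //.
  exact: corner_verts.
apply: (disj (pos M v)); last by exists f => //; exact: pos_in_triangle.
by rewrite BA; exists f => //; exact: pos_in_triangle.
Qed.

(** An l^1 norm of the discrete gradient. *)
Definition grad_size (x : V -> R) : R := \sum_f \sum_(i < 3) `|face_grad x f i 0|.

Lemma grad_size_ge0 x : 0 <= grad_size x.
Proof. by do 2 (apply: sumr_ge0 => ? _). Qed.

Lemma face_oscillation f i : exists2 C : R, 0 <= C &
  forall x, `|x (corner M f i) - x (corner M f ord0)| <= C * grad_size x.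
Proof.
have [j ->|->] := unliftP ord0 i; last first.
  by exists 0 => // x; rewrite subrr normr0 mul0r.
exists (\sum_(l < 3) `|Jmx M f l j|); first exact: sumr_ge0.
move=> x; rewrite face_grad_edge (le_trans (ler_norm_sum _ _ _))// mulr_suml.
apply: ler_sum => l _; rewrite normrM ler_wpM2l//.
rewrite /grad_size (bigD1 f)//= (bigD1 l)//= -addrA lerDl addr_ge0//.
  exact: sumr_ge0.
by do 2 (apply: sumr_ge0 => ? _).
Qed.

(** A discrete Poincare inequality. The vertices w for which |x v - x w| is
    controlled form a set closed under passing to another vertex of a triangle. *)
Lemma oscillation_le : exists2 C : R, 0 <= C &
  forall x v w, `|x v - x w| <= C * grad_size x.
Proof.
pose P v w := exists2 C : R, 0 <= C & forall x, `|x v - x w| <= C * grad_size x.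
have PP u v w : P u v -> P v w -> P u w.
  move=> [C C0 hC] [D D0 hD]; exists (C + D); first exact: addr_ge0.
  by move=> x; rewrite mulrDl (le_trans (ler_distD (x v) _ _))// lerD.
have Psym u v : P u v -> P v u.
  by move=> [C C0 hC]; exists C => // x; rewrite distrC.
have Pf f v w : v \in verts M f -> w \in verts M f -> P v w.
  move=> /imsetP[i _ ->] /imsetP[j _ ->].
  by apply: (PP _ (corner M f ord0)); last apply: Psym; exact: face_oscillation.
have Pall v w : P v w.
  suff : w \in [set w | `[< P v w >]]%SET by rewrite inE => /asboolP.
  apply: (@mesh_connected_verts _ v) => [|f u u' uf u'f].
    by rewrite inE; apply/asboolP; exists 0 => // x; rewrite subrr normr0 mul0r.
  rewrite inE => /asboolP Pvu; rewrite inE; apply/asboolP.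

  exact: PP _ _ _ Pvu (Pf f _ _ uf u'f).
have /choice[C hC] : forall vw : V * V, exists C : R, 0 <= C /\
    forall x, `|x vw.1 - x vw.2| <= C * grad_size x.
  by move=> [v w]; have [C C0 hC] := Pall v w; exists C.
exists (\sum_vw C vw); first by apply: sumr_ge0 => vw _; case: (hC vw).
move=> x v w; apply: le_trans (proj2 (hC (v, w)) x) _.
rewrite ler_wpM2r ?grad_size_ge0// (bigD1 (v, w))//= lerDl.
by apply: sumr_ge0 => vw _; case: (hC vw).
Qed.

End MeshGeometry.

(** * Expansion and adjoints of the discrete operators *)

Section Operators.
Context {R : realType} {V T : finType} (M : trimesh R V T) {N : nat}.
Implicit Types (phi psi : {ffun Vc N V -> R}) (B : {ffun Tc N T -> 'cV[R]_3}).

Local Notation weightV := (weightV M (N := N)).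

Definition cross_dot {I : finType} (B B' : {ffun I -> 'cV[R]_3}) : {ffun I -> R} :=
  [ffun i => \sum_(j < 3) B i j 0 * B' i j 0].

Lemma scale_ffunE (I : finType) (t : R) (x : {ffun I -> R}) i :
  (t *: x) i = t * x i.
Proof. by rewrite ffunE. Qed.

Lemma grad_t_line phi psi t : grad_t (phi + t *: psi) = grad_t phi + t *: grad_t psi.
Proof. by apply/ffunP => kv; rewrite !ffunE /GRing.scale/=; ring. Qed.

Lemma grad_sE phi k f : grad_s M phi (k, f) = face_grad M (fun v => phi (k, v)) f.
Proof. by rewrite ffunE. Qed.

Lemma grad_s_line phi psi t :
  grad_s M (phi + t *: psi) = grad_s M phi + t *: grad_s M psi.
Proof.
apply/ffunP => kf; rewrite !ffunE scaler_sumr -big_split.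
by apply: eq_bigr => i _; rewrite !ffunE scalerDl scalerA.
Qed.

Lemma interp_t_line phi psi t :
  interp_t (phi + t *: psi) = interp_t phi + t *: interp_t psi.
Proof. by apply/ffunP => kv; rewrite !ffunE /GRing.scale/=; ring. Qed.

Lemma interp_s_adj_line (y z : {ffun Tc N T -> R}) t :
  interp_s_adj M (y + t *: z) = interp_s_adj M y + t *: interp_s_adj M z.
Proof.
apply/ffunP => kv; rewrite !ffunE /= -[_ *: (_ * _)]/(t * _).
rewrite [X in _ = _ + X]mulrCA. rewrite -mulrDr.
congr (_ * _).
rewrite mulr_sumr -big_split; apply: eq_bigr => f _.
by rewrite !ffunE -[_ *: z _]/(t * _) mulrDr mulrCA.
Qed.

Lemma normsq_line (I : finType) (B B' : {ffun I -> 'cV[R]_3}) t :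
  normsq (B + t *: B') =
  normsq B + (2 * t) *: (cross_dot B B' + (t / 2) *: normsq B').
Proof.
apply/ffunP => i; rewrite !ffunE /GRing.scale/= !mulr_sumr -!big_split mulr_sumr.
by rewrite -big_split; apply: eq_bigr => j _; rewrite !mxE /=; field.
Qed.

Definition dconstraint phi psi : {ffun Vst N V -> R} :=
  grad_t psi + interp_t (interp_s_adj M (cross_dot (grad_s M phi) (grad_s M psi))).

Definition energy phi : {ffun Vc N V -> R} := interp_s_adj M (normsq (grad_s M phi)).

Lemma constraint_line phi psi t :
  constraint_fun M (grad_t (phi + t *: psi)) (grad_s M (phi + t *: psi)) =
  constraint_fun M (grad_t phi) (grad_s M phi) + t *: dconstraint phi psi
  + t ^+ 2 *: (2^-1 *: interp_t (energy psi)).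
Proof.
rewrite /constraint_fun /dconstraint /energy grad_t_line grad_s_line normsq_line.
rewrite !interp_s_adj_line !interp_t_line.
move: (interp_t _) (interp_t (interp_s_adj M (cross_dot _ _))) => a b.
move: (interp_t _) (grad_t phi) (grad_t psi) => d u u'.
by apply/ffunP => kv; rewrite !(scale_ffunE, ffunE); field.
Qed.

Lemma sum_fiber (I J : finType) (h : J -> I) (F : I -> R) (G : J -> R) :
  \sum_i F i * (\sum_(j | h j == i) G j) = \sum_j F (h j) * G j.
Proof.
rewrite [RHS](partition_big h predT)//=; apply: eq_bigr => i _.
by rewrite mulr_sumr; apply: eq_bigr => j /eqP ->.
Qed.

Lemma dot_pair (I J : finType) (x y : {ffun I * J -> R}) :
  dot x y = \sum_j \sum_i x (i, j) * y (i, j).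
Proof. by rewrite exchange_big pair_big; apply: eq_bigr => -[]. Qed.

(** Adjointness for the inner products weighted by the vertex areas. *)
Lemma interp_t_adjoint phi (lam : {ffun Vst N V -> R}) :
  dot (interp_t phi) (weightV lam) = dot phi (weightV (interp_t_adj lam)).
Proof.
rewrite !dot_pair; apply: eq_bigr => v _.
pose G j := 2^-1 * (varea M v / N%:R) * lam (j, v).
transitivity (\sum_j phi (tnext j, v) * G j + \sum_j phi (tprev j, v) * G j).
  rewrite -big_split; apply: eq_bigr => j _; rewrite !ffunE /G /=; ring.
rewrite -(sum_fiber (@tnext N) (fun k => phi (k, v))).
rewrite -(sum_fiber (@tprev N) (fun k => phi (k, v))) -big_split.
apply: eq_bigr => k _; rewrite !ffunE /G /= -!mulr_sumr; ring.
Qed.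

(** The weight of [interp_s_adj] cancels the vertex area, leaving a sum over
    incident pairs (v, f) weighted by the triangle areas. *)
Lemma interp_s_adjoint (hv : forall v, varea M v != 0)
    (z : {ffun Tc N T -> R}) (w : {ffun Vc N V -> R}) :
  dot (interp_s_adj M z) (weightV w) =
  \sum_kf tarea M kf.2 / N%:R * interp_s M w kf * z kf.
Proof.
rewrite dot_pair exchange_big.
transitivity (\sum_k \sum_f tarea M f / N%:R * interp_s M w (k, f) * z (k, f)); last first.
  by rewrite pair_big; apply: eq_bigr => -[].
apply: eq_bigr => k _.
transitivity (\sum_v \sum_(f in star M v)
    3^-1 / N%:R * (tarea M f * z (k, f) * w (k, v))).
  apply: eq_bigr => v _; rewrite -mulr_sumr -mulr_suml !ffunE /= invfM.
  rewrite mulrACA; move: (\sum_(f in _) _) (hv v) => s hvv.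
  by have [->|n0] := eqVneq (N%:R : R) 0; [rewrite invr0; ring|field; rewrite n0 hvv].
rewrite (exchange_big_dep predT)//=; apply: eq_bigr => f _.
rewrite ffunE /= mulrA mulr_sumr mulr_suml.
apply: eq_big => [v|v _]; first by rewrite inE.
by ring.
Qed.

(** The derivative of the constraint, paired with lam, is the left-hand side of
    the continuity equation tested against psi, for the momentum
    (L_s L_t^* lam) B prescribed by the KKT system. *)
Lemma lagrangian_derivative (hv : forall v, varea M v != 0) phi psi
    (lam : {ffun Vst N V -> R}) :
  dot (dconstraint phi psi) (weightV lam) =
  dot (grad_t psi) (weightV lam) +
  dot3 (grad_s M psi)
    (weightT M (hadamard (kron_ones (interp_s M (interp_t_adj lam))) (grad_s M phi))).
Proof.
transitivity (dot (grad_t psi) (weightV lam) + dot (interp_t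
   (interp_s_adj M (cross_dot (grad_s M phi) (grad_s M psi)))) (weightV lam)).
  by rewrite -big_split; apply: eq_bigr => kv _; rewrite ffunE mulrDl.
congr (_ + _); rewrite interp_t_adjoint interp_s_adjoint//.
apply: eq_bigr => kf _; rewrite [cross_dot _ _ _]ffunE mulr_sumr.
apply: eq_bigr => j _; rewrite [weightT _ _ _]ffunE !mxE.
by rewrite ![hadamard _ _ _]ffunE !mxE [kron_ones _ _]ffunE !mxE; ring.
Qed.

End Operators.

(** * Coercivity modulo additive constants *)

Lemma telescope_ord (R : zmodType) N (F : 'I_N.+1 -> R) :
  \sum_(k < N) (F (tprev k) - F (tnext k)) = F ord0 - F ord_max.
Proof.
transitivity (- \sum_(0 <= k < N) (F (inord k.+1) - F (inord k))).
  rewrite big_mkord -sumrN; apply: eq_bigr => k _; rewrite opprB.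
  congr (F _ - F _); apply: val_inj; rewrite /= inordK ?ltnS//.
    by rewrite /bump leqNgt ltn_ord.
  exact/ltnW/ltn_ord.
rewrite telescope_sumr// opprB; congr (F _ - F _); apply: val_inj;
  by rewrite /= inordK.
Qed.

Lemma almost_nonincreasing (R : realDomainType) N (F : 'I_N.+1 -> R) (s : R) :
  0 <= s -> (forall k, F (tnext k) <= F (tprev k) + s) ->
  forall i j : 'I_N.+1, (i <= j)%N -> F j <= F i + N%:R * s.
Proof.
move=> s0 hF i j ij.
suff h n : (i + n <= N)%N -> F (inord (i + n)) <= F i + n%:R * s.
  have := h (j - i)%N; rewrite subnKC// inord_val -ltnS => /(_ (ltn_ord j)) /le_trans.
  apply; rewrite lerD2l ler_wpM2r// ler_nat (leq_trans (leq_subr _ _))//.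
  by rewrite -ltnS ltn_ord.
elim: n => [|n IHn] inN; first by rewrite addn0 inord_val mul0r addr0.
have lt : (i + n < N)%N by rewrite -addnS.
have := hF (Ordinal lt).
have -> : tnext (Ordinal lt) = inord (i + n.+1).
  by apply: val_inj; rewrite /= inordK ?ltnS// addnS.
have -> : tprev (Ordinal lt) = inord (i + n).
  apply: val_inj; rewrite /= inordK ?ltnS ?(ltnW lt)//.
  by rewrite /bump leqNgt lt.
move/le_trans; apply; rewrite -natr1 mulrDl mul1r addrA lerD2r.
exact/IHn/ltnW.
Qed.

Lemma time_neighbour N (i : 'I_N.+1) : (0 < N)%N ->
  (exists k : 'I_N, i = tnext k) \/ (exists k : 'I_N, i = tprev k).
Proof.
case: N i => // N i _; have [j ->|->] := unliftP ord0 i; first by left; exists j.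
by right; exists ord0; apply: val_inj.
Qed.

Section Coercivity.
Context {R : realType} {V T : finType} (M : trimesh R V T) (hM : is_mesh M).
Context {N : nat} (N_gt0 : (0 < N)%N).
Implicit Types (phi : {ffun Vc N V -> R}).

Definition slice_energy phi k : R := \sum_w energy M phi (k, w).

Lemma energy_ge0 phi kv : 0 <= energy M phi kv.
Proof.
rewrite ffunE mulr_ge0//.
  by rewrite invr_ge0 mulr_ge0//; exact/ltW/(varea_gt0 hM).
apply: sumr_ge0 => f _; rewrite mulr_ge0 ?(ltW (tarea_gt0 hM _))//.
by rewrite ffunE; apply: sumr_ge0 => i _; exact: sqr_ge0.
Qed.

Lemma slice_energy_ge0 phi k : 0 <= slice_energy phi k.
Proof. by apply: sumr_ge0 => w _; exact: energy_ge0. Qed.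

(** A triangle contributes to the local energy of its first corner. *)
Lemma normsq_le_slice_energy : exists2 c : R, 0 < c &
  forall phi k f, normsq (grad_s M phi) (k, f) <= c * slice_energy phi k.
Proof.
pose c f := 3 * varea M (corner M f ord0) / tarea M f.
have c0 f : 0 < c f.
  by rewrite divr_gt0 ?(tarea_gt0 hM)// mulr_gt0 ?(varea_gt0 hM).
have S0 : 0 <= \sum_f c f by apply: sumr_ge0 => f _; exact: ltW.
exists (1 + \sum_f c f); first by rewrite ltr_pwDl.
move=> phi k f.
have h : normsq (grad_s M phi) (k, f) <= c f * slice_energy phi k.
  have n0 g : 0 <= tarea M g * normsq (grad_s M phi) (k, g).
    rewrite mulr_ge0 ?(ltW (tarea_gt0 hM _))//.
    by rewrite ffunE; apply: sumr_ge0 => i _; exact: sqr_ge0.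
  have : energy M phi (k, corner M f ord0) <= slice_energy phi k.
    rewrite /slice_energy (bigD1 (corner M f ord0))//= lerDl.
    by apply: sumr_ge0 => w _; exact: energy_ge0.
  move/(ler_wpM2l (ltW (c0 f)))/(le_trans _); apply.
  rewrite [energy _ _ _]ffunE /= mulrA.
  have -> : c f * (3 * varea M (corner M f ord0))^-1 = (tarea M f)^-1.
    have := varea_gt0 hM (corner M f ord0); have := tarea_gt0 hM f.
    by rewrite /c => ? ?; field; rewrite !gt_eqF.
  rewrite ler_pdivlMl ?(tarea_gt0 hM)// (bigD1 f)/=; last by rewrite inE corner_verts.
  by rewrite lerDl; exact: sumr_ge0.
apply: le_trans h _; rewrite ler_wpM2r ?slice_energy_ge0//.
rewrite (bigD1 f)//= addrCA lerDl addr_ge0//.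
by apply: sumr_ge0 => g _; exact: ltW.
Qed.

(** The oscillation is at most a multiple of the square root of the energy;
    Young's inequality trades this for an arbitrarily small multiple of the
    energy, which the dissipation can absorb. *)
Lemma slice_oscillation_le (eps : R) : 0 < eps -> exists2 K : R, 0 <= K &
  forall phi k v w, `|phi (k, v) - phi (k, w)| <= K + eps * slice_energy phi k.
Proof.
move=> eps0; have [C C0 hC] := oscillation_le hM.
have [c c0 hc] := normsq_le_slice_energy.
pose d := eps / (#|T|%:R * c + 1).
have den0 : 0 < #|T|%:R * c + 1 by rewrite ltr_wpDl// mulr_ge0// ltW.
have d0 : 0 < d by rewrite divr_gt0.
pose K := C ^+ 2 / (4 * d).
have young (b : R) : C * `|b| <= K + d * b ^+ 2.
  have -> : b ^+ 2 = `|b| ^+ 2 by rewrite real_normK ?num_real.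
  have : 0 <= d * (`|b| - C / (2 * d)) ^+ 2 by rewrite mulr_ge0 ?sqr_ge0// ltW.
  have -> : d * (`|b| - C / (2 * d)) ^+ 2 = d * `|b| ^+ 2 - C * `|b| + K.
    by rewrite /K; field; rewrite gt_eqF.
  by lra.
have K0 : 0 <= K by rewrite divr_ge0 ?sqr_ge0// mulr_ge0// ltW.
exists (\sum_(f : T) \sum_(i < 3) K).
  by do 2 (apply: sumr_ge0 => ? _).
move=> phi k v w.
apply: le_trans (hC (fun v => phi (k, v)) v w) _; rewrite /grad_size mulr_sumr.
have : \sum_f d * normsq (grad_s M phi) (k, f) <= eps * slice_energy phi k.
  apply: (@le_trans _ _ (\sum_(f : T) d * (c * slice_energy phi k))).
    by apply: ler_sum => f _; rewrite ler_wpM2l ?hc// ltW.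
  have dE : d * (#|T|%:R * c + 1) = eps by rewrite divfK// gt_eqF.
  have le1 : #|T|%:R * (d * c) <= eps.
    by rewrite -[leRHS]dE mulrDr mulr1 mulrCA lerDl ltW.
  rewrite sumr_const -[leLHS]mulr_natl [d * _]mulrA mulrA.
  by rewrite ler_wpM2r ?slice_energy_ge0.
move=> h; apply: le_trans (lerD (lexx _) h); rewrite -big_split.
apply: ler_sum => f _; rewrite mulr_sumr [normsq _ _]ffunE mulr_sumr -big_split.
by apply: ler_sum => i _; rewrite grad_sE; exact: young.
Qed.

Local Notation constraint phi := (constraint_fun M (grad_t phi) (grad_s M phi)).

Lemma constraintE phi k v : constraint phi (k, v) =
  N%:R * (phi (tnext k, v) - phi (tprev k, v))
  + 4^-1 * (energy M phi (tnext k, v) + energy M phi (tprev k, v)).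
Proof.
rewrite /constraint_fun -/(energy M phi); move: (energy _ _) => e.
by rewrite !(scale_ffunE, ffunE) /=; field.
Qed.

Lemma NR_ge1 : 1 <= N%:R :> R.
Proof. by rewrite ler1n. Qed.

(** Up to the violation of the constraint, a potential dissipates in time at
    least its local energy. *)
Lemma decrement_ge phi k v :
  phi (tprev k, v) - phi (tnext k, v) >=
  (energy M phi (tnext k, v) + energy M phi (tprev k, v)) / (4 * N%:R)
  - pos_part (constraint phi (k, v)).
Proof.
have N1 := NR_ge1; have := le_pos_part (constraint phi (k, v)).
have := pos_part_ge0 (constraint phi (k, v)).
move: (pos_part _) => p p0; rewrite constraintE.
set d := phi _ - phi _; set d' := phi _ - phi _; set e := energy M _ _ + _ => h.
have dd : d' = - d by rewrite /d /d' opprB.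
have : (e / (4 * N%:R) - p - d') * N%:R <= 0.
  rewrite dd.
  have -> : (e / (4 * N%:R) - p - - d) * N%:R = N%:R * d + 4^-1 * e - N%:R * p.
    by field; rewrite gt_eqF// (lt_le_trans ltr01).
  by have : p <= N%:R * p by [rewrite ler_peMl]; move: h; lra.
by rewrite pmulr_lle0 ?subr_le0// (lt_le_trans ltr01).
Qed.

Definition violation phi : R := \sum_kv pos_part (constraint phi kv).
Definition dissipation phi : R :=
  \sum_(k < N) (slice_energy phi (tnext k) + slice_energy phi (tprev k)).

Lemma violation_ge phi kv : pos_part (constraint phi kv) <= violation phi.
Proof.
rewrite /violation (bigD1 kv)//= lerDl; apply: sumr_ge0 => i _.
exact: pos_part_ge0.
Qed.

Lemma violation_ge0 phi : 0 <= violation phi.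
Proof. by apply: sumr_ge0 => i _; exact: pos_part_ge0. Qed.

Lemma slice_energy_le_dissipation phi k : slice_energy phi k <= dissipation phi.
Proof.
have ge0 i := slice_energy_ge0 phi i.
have rest (j : 'I_N) : 0 <= \sum_(i < N | i != j)
    (slice_energy phi (tnext i) + slice_energy phi (tprev i)).
  by apply: sumr_ge0 => i _; rewrite addr_ge0.
case: (time_neighbour k N_gt0) => -[j ->]; rewrite /dissipation (bigD1 j)//=.
  by rewrite -addrA lerDl addr_ge0.
by rewrite addrAC addrC lerDl addr_ge0.
Qed.

Lemma dissipation_ge0 phi : 0 <= dissipation phi.
Proof. exact: le_trans (slice_energy_ge0 _ ord0) (slice_energy_le_dissipation _ _). Qed.

Lemma total_decrement_ge phi :
  dissipation phi / (4 * N%:R) - violation phi <=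
  \sum_w (phi (ord0, w) - phi (ord_max, w)).
Proof.
have -> : violation phi = \sum_(k < N) \sum_v pos_part (constraint phi (k, v)).
  by rewrite pair_big; apply: eq_bigr => -[].
under [leRHS]eq_bigr => w _ do rewrite -(telescope_ord (fun k => phi (k, w))).
rewrite [leRHS]exchange_big /dissipation mulr_suml -sumrB; apply: ler_sum => k _.
rewrite /slice_energy -big_split mulr_suml -sumrB.
by apply: ler_sum => v _; exact: decrement_ge.
Qed.

Lemma forward_le phi w (i j : 'I_N.+1) : (i <= j)%N ->
  phi (j, w) <= phi (i, w) + N%:R * violation phi.
Proof.
apply: (almost_nonincreasing (F := fun k => phi (k, w))).
  exact: violation_ge0.
move=> k; have := decrement_ge phi k w; have := violation_ge phi (k, w).
have : 0 <= (energy M phi (tnext k, w) + energy M phi (tprev k, w)) / (4 * N%:R).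
  by rewrite divr_ge0 ?addr_ge0 ?energy_ge0 ?mulr_ge0.
by lra.
Qed.

Context (mu0 muN : V -> R) (hmu0 : is_density M mu0) (hmuN : is_density M muN).
Local Notation cost := (boundary_cost M mu0 muN).

Lemma density_mean_ge mu (F : V -> R) a : is_density M mu ->
  (forall v, a <= F v) -> a <= \sum_v varea M v * F v * mu v.
Proof.
move=> [mu_ge0 mu1] aF; rewrite -[leLHS]mulr1 -mu1 mulr_sumr.
apply: ler_sum => v _; rewrite mulrCA mulrA ler_wpM2r// ler_wpM2l//.
exact/ltW/(varea_gt0 hM).
Qed.

Lemma density_mean_le mu (F : V -> R) a : is_density M mu ->
  (forall v, F v <= a) -> \sum_v varea M v * F v * mu v <= a.
Proof.
move=> [mu_ge0 mu1] aF; rewrite -[leRHS]mulr1 -mu1 mulr_sumr.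
apply: ler_sum => v _; rewrite [leRHS]mulrCA [leRHS]mulrA ler_wpM2r// ler_wpM2l//.
exact/ltW/(varea_gt0 hM).
Qed.

(** The densities have mass 1, so both means in the cost differ from the value
    at w by at most the oscillation a. *)
Lemma cost_ge phi w a :
  (forall k v w, `|phi (k, v) - phi (k, w)| <= a) ->
  phi (ord0, w) - phi (ord_max, w) - 2 * a <= cost phi.
Proof.
move=> osc.
have h0 : phi (ord0, w) - a <= \sum_v varea M v * phi (ord0, v) * mu0 v.
  apply: (density_mean_ge (F := fun v => phi (ord0, v)) hmu0) => v.
  by have := osc ord0 w v; rewrite ler_norml => /andP[]; lra.
have hN : \sum_v varea M v * phi (ord_max, v) * muN v <= phi (ord_max, w) + a.
  apply: (density_mean_le (F := fun v => phi (ord_max, v)) hmuN) => v.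
  by have := osc ord_max w v; rewrite ler_norml => /andP[]; lra.
by rewrite /boundary_cost; lra.
Qed.

(** The penalty controls the total violation, and the cost controls the
    dissipation minus oscillation terms that a small [eps] absorbs. Once the
    dissipation and the violation are bounded, so are the oscillation of every
    slice and the change of phi in time. *)
Lemma sublevel_bounded (v0 : V) (K : R) : exists C : R, forall phi,
  cost phi + 2^-1 * \sum_kv pos_part (constraint phi kv) ^+ 2 <= K ->
  forall k v, `|phi (k, v) - phi (ord0, v0)| <= C.
Proof.
pose n : R := #|V|%:R.
have n1 : 1 <= n by rewrite ler1n; apply/card_gt0P; exists v0.
have N1 := NR_ge1.
have n0 : 0 < n by exact: lt_le_trans n1.
have NR0 : 0 < N%:R :> R by exact: lt_le_trans N1.
(* This choice makes the oscillation terms half of the dissipation term. *)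
pose eps : R := (16 * n * N%:R)^-1.
have eps0 : 0 < eps by rewrite invr_gt0 !mulr_gt0.
have [K0 K0_ge0 hK0] := slice_oscillation_le eps0.
pose m : R := \sum_(kv : Vst N V) 1.
pose K1 := n * `|K| + 2 * n * K0 + 2 * m.
pose K2 := K0 + eps * (8 * N%:R * K1).
exists (N%:R * K1 + `|K| + 3 * K2) => phi; set Q := \sum_kv _ => hK k v.
set D := dissipation phi; set S := violation phi.
have D0 : 0 <= D := dissipation_ge0 phi.
have S0 : 0 <= S := violation_ge0 phi.
have Q0 : 0 <= Q by apply: sumr_ge0 => kv _; exact: sqr_ge0.
(* Termwise this is (p - 2)^2 >= 0. *)
have SQ : 2 * S - 2 * m <= 2^-1 * Q.
  rewrite /S /violation /m /Q !mulr_sumr -sumrB; apply: ler_sum => kv _.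
  by have := sqr_ge0 (pos_part (constraint phi kv) - 2); lra.
have osc i u w : `|phi (i, u) - phi (i, w)| <= K0 + eps * D.
  apply: le_trans (hK0 phi i u w) _; rewrite lerD2l ler_wpM2l ?(ltW eps0)//.
  exact: slice_energy_le_dissipation.
have costD : D / (4 * N%:R) - S <= n * (cost phi + 2 * (K0 + eps * D)).
  apply: le_trans (total_decrement_ge phi) _.
  rewrite /n mulr_natl -sumr_const; apply: ler_sum => w _.
  by have := cost_ge w osc; lra.
have epsE : n * (2 * (eps * D)) = D / (8 * N%:R).
  by rewrite /eps; field; rewrite !gt_eqF.
have D4 : D / (4 * N%:R) = 2 * (D / (8 * N%:R)) by field; rewrite gt_eqF.
have hKn : n * (cost phi + 2^-1 * Q) <= n * `|K|.
  by rewrite ler_wpM2l ?(ltW n0)// (le_trans hK) ?ler_norm.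
have nQ : 2^-1 * Q <= n * (2^-1 * Q) by rewrite ler_peMl// mulr_ge0.
have DS : D / (8 * N%:R) + S <= K1 by rewrite /K1; lra.
have D8 : 0 <= D / (8 * N%:R) by rewrite divr_ge0 ?mulr_ge0.
have DK : D <= 8 * N%:R * K1.
  by rewrite mulrC -ler_pdivrMr ?mulr_gt0//; lra.
have SK : N%:R * S <= N%:R * K1 by rewrite ler_wpM2l ?(ltW NR0)//; lra.
have {}osc i u w : `|phi (i, u) - phi (i, w)| <= K2.
  by apply: le_trans (osc i u w) _; rewrite lerD2l ler_wpM2l ?(ltW eps0).
have := cost_ge v osc; have := forward_le phi v (leq0n k : (ord0 <= k)%N).
have := forward_le phi v (leq_ord k : (k <= (ord_max : 'I_N.+1))%N).
have := osc ord0 v v0; rewrite !ler_norml -/S => /andP[? ?] ? ? ?.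
have := ler_norm K; have : 0 <= 2^-1 * Q by rewrite mulr_ge0.
have : 0 <= `|K| by [].
by move=> ? ? ?; apply/andP; split; lra.
Qed.

End Coercivity.

(** * The dual problem as a quadratic program *)

Section DualProblem.
Import ArrowAsProduct.
Context {R : realType} {V T : finType} (M : trimesh R V T) {N : nat}.
Implicit Types (x y : Vc N V -> R).
Local Notation "'\ff' x" := (finfun x : {ffun Vc N V -> R}) (at level 10).

Definition constraint_at (kv : Vst N V) x : R :=
  constraint_fun M (grad_t (\ff x)) (grad_s M (\ff x)) kv.
Definition dconstraint_at (kv : Vst N V) x y : R := dconstraint M (\ff x) (\ff y) kv.
Definition curvature_at (kv : Vst N V) y : R :=
  (2^-1 *: interp_t (energy M (\ff y))) kv.

Lemma finfun_move_by x y t : \ff (move_by x y t) = \ff x + t *: \ff y.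
Proof. by apply/ffunP => i; rewrite !(scale_ffunE, ffunE). Qed.

Lemma constraint_at_line kv x y t :
  constraint_at kv (move_by x y t) =
  constraint_at kv x + t * dconstraint_at kv x y + t ^+ 2 * curvature_at kv y.
Proof.
rewrite /constraint_at finfun_move_by constraint_line /dconstraint_at /curvature_at.
move: (dconstraint _ _ _) (2^-1 *: _) (constraint_fun _ _ _) => a b c.
by rewrite !(scale_ffunE, ffunE).
Qed.

Lemma boundary_cost_line mu0 muN x y t :
  boundary_cost M mu0 muN (\ff (move_by x y t)) =
  boundary_cost M mu0 muN (\ff x) + t * boundary_cost M mu0 muN (\ff y).
Proof.
rewrite /boundary_cost mulrBr !mulr_sumr addrACA -opprD -!big_split.
by congr (_ - _); apply: eq_bigr => v _; rewrite !ffunE /move_by /=; ring.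
Qed.

Lemma cont_finfun i : continuous (fun x => (\ff x) i).
Proof.
under [X in continuous X]eq_fun => x do rewrite ffunE.
exact: cont_coord.
Qed.

Lemma cont_grad_t kv : continuous (fun x => grad_t (\ff x) kv).
Proof.
under [X in continuous X]eq_fun => x do rewrite ffunE.
apply: cont_mul; first exact: cont_cst.
by apply: cont_add; [|apply: cont_opp]; exact: cont_finfun.
Qed.

Lemma cont_grad_s kf i : continuous (fun x => grad_s M (\ff x) kf i 0).
Proof.
under [X in continuous X]eq_fun => x do rewrite ffunE summxE.
apply: cont_sum => j; under [X in continuous X]eq_fun => x do rewrite mxE.
by apply: cont_mul; [exact: cont_finfun|exact: cont_cst].
Qed.

Lemma cont_interp (B : (Vc N V -> R) -> {ffun Tc N T -> R}) kv :
  (forall kf, continuous (fun x => B x kf)) ->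
  continuous (fun x => interp_t (interp_s_adj M (B x)) kv).
Proof.
move=> cB; under [X in continuous X]eq_fun => x do rewrite !ffunE.
apply: cont_mul; first exact: cont_cst.
by apply: cont_add; apply: cont_mul; try exact: cont_cst;
  apply: cont_sum => f; apply: cont_mul => //; exact: cont_cst.
Qed.

Lemma cont_constraint kv : continuous (constraint_at kv).
Proof.
under [X in continuous X]eq_fun => x do rewrite /constraint_at ffunE scale_ffunE.
apply: cont_add; first exact: cont_grad_t.
apply: cont_mul; first exact: cont_cst.
apply: cont_interp => kf; under [X in continuous X]eq_fun => x do rewrite ffunE.
by apply: cont_sum => i; apply: cont_mul; exact: cont_grad_s.
Qed.

Lemma cont_dconstraint kv y : continuous (fun x => dconstraint_at kv x y).
Proof.
under [X in continuous X]eq_fun => x do rewrite /dconstraint_at ffunE.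
apply: cont_add; first exact: cont_cst.
apply: cont_interp => kf; under [X in continuous X]eq_fun => x do rewrite ffunE.
apply: cont_sum => i; apply: cont_mul; first exact: cont_grad_s.
exact: cont_cst.
Qed.

Lemma cont_cost mu0 muN : continuous (fun x => boundary_cost M mu0 muN (\ff x)).
Proof.
apply: cont_add; last apply: cont_opp; apply: cont_sum => v;
  apply: cont_mul; try exact: cont_cst;
  by apply: cont_mul; [exact: cont_cst|exact: cont_finfun].
Qed.

Lemma face_grad_cst (a : R) f : face_grad M (fun=> a) f = 0.
Proof.
rewrite face_gradE /hat_grads -mulmxA (_ : _ *m (\col_i a) = 0) ?mulmx0//.
apply/colP => i; rewrite !mxE.
under eq_bigr => j _ do rewrite !mxE mulrBl.
by rewrite sumrB !sum_indicator subrr.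
Qed.

Lemma grad_s_time (a : 'I_N.+1 -> R) : grad_s M (\ff (fun kv => a kv.1)) = 0.
Proof.
apply/ffunP => -[k f]; rewrite grad_sE [RHS]ffunE.
apply: etrans (face_grad_cst (a k) f).
by apply: eq_bigr => i _; rewrite !ffunE.
Qed.

Lemma constraint_at_time (a : 'I_N.+1 -> R) kv :
  constraint_at kv (fun kv => a kv.1) = N%:R * (a (tnext kv.1) - a (tprev kv.1)).
Proof.
rewrite /constraint_at grad_s_time ffunE scale_ffunE !ffunE /=.
have n0 kf : normsq (0 : {ffun Tc N T -> 'cV[R]_3}) kf = 0.
  by rewrite ffunE big1// => i _; rewrite ffunE mxE expr0n.
by rewrite !big1 ?(mulr0, addr0)// => f _; rewrite n0 mulr0.
Qed.

Lemma constraint_at_shift kv x a :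
  constraint_at kv (move_by x (fun=> 1) a) = constraint_at kv x.
Proof.
rewrite /constraint_at finfun_move_by grad_t_line grad_s_line.
rewrite (grad_s_time (fun=> 1)) scaler0 addr0 (_ : grad_t (\ff (fun=> 1)) = 0).
  by rewrite scaler0 addr0.
by apply/ffunP => kw; rewrite !ffunE subrr mulr0.
Qed.

Lemma boundary_cost_cst mu0 muN : is_density M mu0 -> is_density M muN ->
  boundary_cost M mu0 muN (\ff (fun=> 1)) = 0.
Proof.
move=> [_ h0] [_ hN]; apply/eqP; rewrite subr_eq0; apply/eqP.
transitivity (\sum_v varea M v * mu0 v).
  by apply: eq_bigr => v _; rewrite ffunE /= mulr1.
by rewrite h0 -[LHS]hN; apply: eq_bigr => v _; rewrite ffunE mulr1.
Qed.

Lemma curvature_ge0 (hM : is_mesh M) kv y : 0 <= curvature_at kv y.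
Proof.
have e0 := energy_ge0 hM (\ff y); rewrite /curvature_at.
move: (energy _ _) e0 => e e0; rewrite scale_ffunE ffunE.
by rewrite !mulr_ge0 ?addr_ge0.
Qed.

(** Normalizing the potential to vanish at one node changes neither the cost nor
    the constraints, since both densities have the same mass. *)
Lemma coercive_modulo_constants (hM : is_mesh M) (N_gt0 : (0 < N)%N) mu0 muN
    (hmu0 : is_density M mu0) (hmuN : is_density M muN) (K : R) :
  exists C : R, forall x,
  boundary_cost M mu0 muN (\ff x) + 2^-1 * excess constraint_at x <= K ->
  exists y, [/\ forall i, `|y i| <= C,
      boundary_cost M mu0 muN (\ff y) = boundary_cost M mu0 muN (\ff x)
    & forall kv, constraint_at kv y = constraint_at kv x].
Proof.
have [v0 _|noV] := pickP (@predT V); last first.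
  case: hmu0 => _; rewrite big1 => [/eqP|v _]; first by rewrite eq_sym oner_eq0.
  by have := noV v.
have [C hC] := sublevel_bounded hM N_gt0 hmu0 hmuN v0 K.
exists C => x /hC {}hC; exists (move_by x (fun=> 1) (- x (ord0, v0))); split.
- by move=> [k v]; rewrite /move_by mulr1; have := hC k v; rewrite !ffunE.
- by rewrite boundary_cost_line boundary_cost_cst// mulr0 addr0.
- by move=> kv; exact: constraint_at_shift.
Qed.

End DualProblem.

(** * Existence of KKT points and of optimal solutions *)

Theorem theorem3p1 (R : realType) (V T : finType) (M : trimesh R V T)
  (hM : is_mesh M) (N : nat) (hN : (1 <= N)%N) (mu0 muN : V -> R)
  (hmu0 : is_density M mu0) (hmuN : is_density M muN)
  (c : {ffun Vc N V -> R})
  (hc : forall phi, innerV M phi c = boundary_cost M mu0 muN phi) :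
  (exists phi q lam0 lamB lamq, KKT M c phi q lam0 lamB lamq) /\
  (exists phi q, optimal M c phi q /\
     exists lam0 lamB lamq, KKT M c phi q lam0 lamB lamq).
Proof.
have a_gt0 := varea_gt0 hM.
have N_gt0 : 0 < N%:R :> R by rewrite ltr0n.
have cf_cost := @cont_cost R V T M N mu0 muN.
have line_cost := boundary_cost_line (N := N) M mu0 muN.
have curv := @curvature_ge0 _ _ _ _ N hM.
(* The potential - k, constant in space. *)
have slater kv : constraint_at M kv (fun kv => - (kv.1 : 'I_N.+1)%:R) <= - 1.
  rewrite (constraint_at_time M (fun k => - k%:R)) /= /bump leq0n leqNgt ltn_ord.
  by rewrite add0n add1n -natr1 opprD opprK addrAC addNr add0r mulrN1 lerN2 ler1n.
have [x [lam [lam_ge0 x_feas compl stat]]] := multipliers_exist cf_cost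
  (@cont_constraint _ _ _ M N) (@cont_dconstraint _ _ _ M N) line_cost
  (@constraint_at_line _ _ _ M N) curv ltr01 slater
  (coercive_modulo_constants hM hN hmu0 hmuN).
pose phi : {ffun Vc N V -> R} := finfun x.
(* The KKT system weights its multipliers by the vertex areas, so the plain
   multipliers are divided by these weights. *)
pose lam0 : {ffun Vst N V -> R} := [ffun kv => lam kv / (varea M kv.2 / N%:R)].
pose lamB := hadamard (kron_ones (interp_s M (interp_t_adj lam0))) (grad_s M phi).
have lam0E : weightV M (N := N) lam0 = [ffun kv => lam kv].
  by apply/ffunP => kv; rewrite !ffunE mulrC divfK// gt_eqF// divr_gt0.
have kkt : KKT M c phi (grad M phi) lam0 lamB (- lam0).
  split=> //=.
  - apply/ffunP => i; rewrite [RHS]ffunE.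
    have sel (F : {ffun Vc N V -> R}) : dot (delta i) F = F i.
      by rewrite /dot; under eq_bigr => j _ do rewrite ffunE; exact: sum_indicator.
    rewrite -sel.
    have -> (F G : {ffun Vc N V -> R}) : dot (delta i) (F + G) =
        dot (delta i) F + dot (delta i) G.
      by rewrite !sel ffunE.
    rewrite -dot_grad_adj /= -(lagrangian_derivative _ phi); last first.
      by move=> v; rewrite gt_eqF.
    rewrite lam0E -/(innerV M (delta i) c) hc.
    have := stat (delta i); rewrite /dconstraint_at (_ : finfun (delta i) = delta i).
      by move=> <-; congr (_ + _); apply: eq_bigr => kv _; rewrite ffunE mulrC.
    by apply/ffunP => j; rewrite ffunE.
  - by rewrite subrr.
  - by move=> kv; rewrite ffunE divr_ge0// ltW// divr_gt0.
  - rewrite /dot big1// => kv _; rewrite ffunE mulrAC.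
    by rewrite [lam kv * _](compl kv) mul0r.
split; first by exists phi, (grad M phi), lam0, lamB, (- lam0).
exists phi, (grad M phi); split; last by exists lam0, lamB, (- lam0).
split; first by split.
move=> phi' q' [<- feas']; rewrite !hc.
have phi'E : finfun phi' = phi' :> {ffun Vc N V -> R}.
  by apply/ffunP => j; rewrite ffunE.
have := lagrangian_le line_cost (@constraint_at_line _ _ _ M N) curv phi' lam_ge0 stat.
rewrite phi'E big1 ?addr0 => [/le_trans|kv _]; last exact: compl.
apply; rewrite gerDl; apply: sumr_le0 => kv _; apply: mulr_ge0_le0 => //.
by rewrite /constraint_at phi'E; exact: feas'.
Qed.
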